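(* Assume that for every positive integer $s$ the following four statements hold (with $k$ ranging over integers): (a) $\prod_{j=1}^{2s} \left( 1 + \frac{2s+1}{k-j} \right) \leq 2$ for all $k\geq \frac{(2s+0.5)^2}{\ln 2}$; (b) $\prod_{j=1}^{2s+1} \left( 1 + \frac{2s+2}{k-j} \right) \leq 2$ for all $k \geq \frac{(2s+1.5)^2}{\ln 2}$; (c) $\prod_{j=0}^{2s-1} \left( 1 + \frac{2s}{k-j} \right) \leq 2$ for all $k \geq \frac{4s^2}{\ln 2}$; (d) $\prod_{j=2}^{2s+1} \left( 1 + \frac{2s+2}{k-j} \right) \leq 2$ for all $k \geq \frac{(2s+1)^2}{\ln 2}$. Let $h(n,n)=\operatorname{hdepth}(S_{n,n}/I_{n,n})$, where $S_{n,n}=K[x_1,\ldots,x_n,y_1,\ldots,y_n]$ and $I_{n,n}=(x_iy_j : 1\leq i,j\leq n)$. Then for every integer $n\geq 1$, $$h(n,n)\geq \left\lfloor \frac{n-1}{2} + \sqrt{\left\lfloor \frac{n}{2}\right\rfloor \ln 2} \right\rfloor.$$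
   Context: $K$ is a field. Polynomial rings over $K$ carry the standard grading (each variable has degree 1). For a finitely generated graded module $M$ over a polynomial ring $S$ over $K$, the Hilbert depth $\operatorname{hdepth}(M)$ is the maximal depth of a finitely generated graded $S$-module $N$ having the same Hilbert series as $M$. *)

(* Defs.v *)
From HB Require Import structures.
From mathcomp Require Import all_boot all_order all_algebra.
From mathcomp Require Import mpoly.
From mathcomp Require Import boolp classical_sets reals constructive_ereal ereal.

Set Implicit Arguments.
Unset Strict Implicit.
Unset Printing Implicit Defensive.

Import Order.TTheory GRing.Theory Num.Theory.
Local Open Scope ring_scope.
Local Open Scope quotient_scope.
Local Open Scope classical_set_scope.

Section GradedModule.
Variables (K : fieldType) (m : nat).

Record is_grading (M : lmodType {mpoly K[m]}) (gr : int -> set M) : Prop :=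
  IsGrading {
    gr_zero : forall d, gr d 0;
    gr_sub : forall d u v, gr d u -> gr d v -> gr d (u - v);
    gr_scale : forall (e : nat) d p v,
      p \is e.-homog -> gr d v -> gr (e%:Z + d) (p *: v);
    gr_sum : forall v, exists (s : seq int) (f : int -> M),
      (forall d, gr d (f d)) /\ v = \sum_(d <- s) f d;
    gr_direct : forall (s : seq int) (f : int -> M),
      uniq s -> (forall d, gr d (f d)) -> \sum_(d <- s) f d = 0 ->
      forall d, d \in s -> f d = 0
  }.

Record graded_module := GradedModule {
  gm_module :> lmodType {mpoly K[m]};
  gm_part : int -> set gm_module;
  gm_grading : is_grading gm_part
}.

Arguments gm_part : clear implicits.

Implicit Type M : graded_module.

Definition finitely_generated M : Prop :=
  exists g : seq M, forall v : M, exists c : 'I_(size g) -> {mpoly K[m]},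
    v = \sum_(i < size g) c i *: g`_i.

(* K acts on M through the constant polynomials. *)
Definition K_basis M (A : set M) (k : nat) (b : 'I_k -> M) : Prop :=
  (forall i, A (b i)) /\
  forall v, A v -> exists! c : {ffun 'I_k -> K}, v = \sum_(i < k) (c i)%:MP *: b i.

(* [hilbert_function M d] is dim_K M_d, with the junk value 0 when M_d is
   infinite-dimensional, which does not happen for finitely generated M. *)
Definition hilbert_function M (d : int) : nat :=
  xget 0%N [set k : nat | exists b : 'I_k -> M, K_basis (gm_part M d) b].

Definition same_hilbert_series M N : Prop :=
  forall d : int, hilbert_function M d = hilbert_function N d.

(* The submodule (rs) M of M. *)
Definition seq_submodule M (rs : seq {mpoly K[m]}) : set M :=
  [set v | exists w : 'I_(size rs) -> M, v = \sum_(i < size rs) rs`_i *: w i].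

Definition regular_sequence M (rs : seq {mpoly K[m]}) : Prop :=
  (forall (i : nat) (v : M), (i < size rs)%N ->
     seq_submodule (take i rs) (rs`_i *: v) -> seq_submodule (take i rs) v) /\
  (exists v : M, ~ seq_submodule rs v).

Definition in_irrelevant_ideal (p : {mpoly K[m]}) : Prop := p@_0%MM = 0.

(* The depth with respect to the ideal generated by the variables: the largest
   length of an M-regular sequence in that ideal.  It is a supremum in \bar R so
   as to be total; for nonzero finitely generated M these lengths are bounded by
   m, so that it is a maximum.  The zero module gets -oo, but it does not share
   its Hilbert series with any nonzero finitely generated module. *)
Definition depth (R : realType) M : \bar R :=
  ereal_sup [set ((size rs)%:R)%:E | rs in
    [set rs | {in rs, forall p, in_irrelevant_ideal p} /\
              regular_sequence M rs]].

(* Again a maximum, as all the depths involved are at most m. *)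
Definition hdepth (R : realType) M : \bar R :=
  ereal_sup [set x | exists N : graded_module,
    [/\ finitely_generated N, same_hilbert_series N M & x = depth R N]].

End GradedModule.

Section QuotientByIdeal.
Variables (K : fieldType) (m : nat) (J : finType) (g : J -> {mpoly K[m]}).

Definition gen_ideal (p : {mpoly K[m]}) : bool :=
   `[< exists c : J -> {mpoly K[m]}, p = \sum_j c j * g j >].

Lemma gen_idealP p :
  reflect (exists c : J -> {mpoly K[m]}, p = \sum_j c j * g j)
          (p \in gen_ideal).
Proof. exact: asboolP. Qed.

Lemma gen_ideal_zmod : zmod_closed gen_ideal.
Proof.
split.
  by apply/gen_idealP; exists (fun=> 0); rewrite big1 // => j; rewrite mul0r.
move=> p q /gen_idealP[c ->] /gen_idealP[d ->]; apply/gen_idealP.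
exists (fun j => c j - d j); rewrite -sumrB.
by apply: eq_bigr => j _; rewrite mulrBl.
Qed.

HB.instance Definition _ :=
  GRing.isZmodClosed.Build {mpoly K[m]} gen_ideal gen_ideal_zmod.

Lemma gen_idealM a p : p \in gen_ideal -> a * p \in gen_ideal.
Proof.
move=> /gen_idealP[c ->]; apply/gen_idealP; exists (fun j => a * c j).
by rewrite mulr_sumr; apply: eq_bigr => j _; rewrite mulrA.
Qed.

Lemma gen_ideal_gen a j : a * g j \in gen_ideal.
Proof.
apply: gen_idealM; apply/gen_idealP; exists (fun k => (k == j)%:R).
rewrite (bigD1 j) //= eqxx mul1r big1 ?addr0 // => k /negPf->.
by rewrite mul0r.
Qed.

Definition gen_ideal_zmodClosed : zmodClosed {mpoly K[m]} :=
  GRing.ZmodClosed.clone {mpoly K[m]} gen_ideal _.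

Definition quot_ideal := {ideal_quot gen_ideal_zmodClosed}.

HB.instance Definition _ := GRing.Zmodule.on quot_ideal.

Definition quot_proj : {mpoly K[m]} -> quot_ideal := \pi_quot_ideal.

Lemma quot_projP x : exists p, x = quot_proj p.
Proof. by exists (repr x); rewrite /quot_proj reprK. Qed.

Lemma quot_proj_eq p q : quot_proj p = quot_proj q <-> p - q \in gen_ideal.
Proof.
split=> [e|h]; last by apply/eqP; rewrite -Quotient.idealrBE.
by have /eqP := e; rewrite -Quotient.idealrBE.
Qed.

Lemma quot_projB : zmod_morphism quot_proj.
Proof. by move=> p q; rewrite /quot_proj raddfB. Qed.

HB.instance Definition _ :=
  GRing.isZmodMorphism.Build {mpoly K[m]} quot_ideal quot_proj quot_projB.

Definition quot_scale (a : {mpoly K[m]}) (x : quot_ideal) : quot_ideal :=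
  quot_proj (a * repr x).

Lemma quot_scaleE a p : quot_scale a (quot_proj p) = quot_proj (a * p).
Proof.
apply/quot_proj_eq; rewrite -mulrBr; apply: gen_idealM.
by apply/quot_proj_eq; rewrite /quot_proj reprK.
Qed.

Fact quot_scaleA a b x :
  quot_scale a (quot_scale b x) = quot_scale (a * b) x.
Proof. by have [p ->] := quot_projP x; rewrite !quot_scaleE mulrA. Qed.

Fact quot_scale1 : left_id 1 quot_scale.
Proof. by move=> x; have [p ->] := quot_projP x; rewrite quot_scaleE mul1r. Qed.

Fact quot_scaleDr : right_distributive quot_scale +%R.
Proof.
move=> a x y; have [p ->] := quot_projP x; have [q ->] := quot_projP y.
by rewrite -raddfD !quot_scaleE mulrDr raddfD.
Qed.

Fact quot_scaleDl x : {morph quot_scale^~ x : a b / a + b}.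
Proof.
move=> a b; have [p ->] := quot_projP x.
by rewrite !quot_scaleE mulrDl raddfD.
Qed.

HB.instance Definition _ := GRing.Zmodule_isLmodule.Build {mpoly K[m]}
  quot_ideal quot_scaleA quot_scale1 quot_scaleDr quot_scaleDl.

Definition quot_part (d : int) : set quot_ideal :=
  [set x | exists2 p : {mpoly K[m]},
     (if d is Posz e then p \is e.-homog else p == 0) & x = quot_proj p].

Lemma gen_ideal_pihomog e p :
  (forall j, exists k : nat, g j \is k.-homog) ->
  p \in gen_ideal -> pihomog mdeg e p \in gen_ideal.
Proof.
move=> hg /gen_idealP[c ->]; rewrite raddf_sum /=.
apply: rpred_sum => j _; have [k gk] := hg j.
rewrite [c j](pihomog_partitionE (leqnn (mmeasure mdeg (c j)))).
rewrite mulr_suml raddf_sum /=; apply: rpred_sum => d _.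
have h : pihomog mdeg d (c j) * g j \is (d + k).-homog.
  by apply: dhomogM => //; apply: pihomogP.
have [<-|ne] := eqVneq (d + k)%N e.
  by rewrite pihomog_dE // gen_ideal_gen.
by rewrite (pihomog_ne0 ne h) rpred0.
Qed.

Lemma quot_part_grading :
  (forall j, exists k : nat, g j \is k.-homog) -> is_grading quot_part.
Proof.
move=> hg; split.
- by move=> d; exists 0; [case: d => // e; rewrite rpred0 | rewrite raddf0].
- move=> d _ _ [p hp ->] [q hq ->]; exists (p - q); last by rewrite raddfB.
  case: d hp hq => [e|e]; first by move=> hp hq; rewrite rpredB.
  by move=> /eqP-> /eqP->; rewrite subr0.
- move=> e d p _ hp [q hq ->]; case: d hq => [f|f] hq.
    exists (p * q); last exact: quot_scaleE.
    exact: dhomogM.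
  move: hq => /eqP->; rewrite raddf0 scaler0; exists 0; last by rewrite raddf0.
  by case: (_ + _) => // k; rewrite rpred0.
- move=> x; have [p ->] := quot_projP x.
  exists [seq Posz i | i <- iota 0 (mmeasure mdeg p)].
  exists (fun d => if d is Posz e then quot_proj (pihomog mdeg e p) else 0); split.
    case=> e; last by exists 0; rewrite ?raddf0.
    by exists (pihomog mdeg e p) => //; apply: pihomogP.
  rewrite big_map.
  rewrite [in LHS](pihomog_partitionE (leqnn (mmeasure mdeg p))) raddf_sum /=.
  by rewrite -(big_mkord xpredT (fun i => quot_proj (pihomog mdeg i p))) /index_iota subn0.
- move=> s f us hf; have /boolp.choice[q hq] : forall d, exists p : {mpoly K[m]},
      (if d is Posz e then p \is e.-homog else p == 0) /\ f d = quot_proj p.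
    by move=> d; have [p ? ?] := hf d; exists p.
  under eq_bigr do rewrite (hq _).2.
  rewrite -raddf_sum -(raddf0 quot_proj) => /quot_proj_eq; rewrite subr0 => sI d ds.
  rewrite (hq d).2; case: d ds => e es.
    2: by have /= [/eqP-> _] := hq (Negz e); rewrite raddf0.
  apply/quot_proj_eq; rewrite subr0.
  have := gen_ideal_pihomog e hg sI.
  rewrite raddf_sum /= (bigD1_seq (Posz e)) //= pihomog_dE ?(hq (Posz e)).1 //.
  rewrite big1 ?addr0 // => -[k|k] ne; last first.
    by have /= [/eqP-> _] := hq (Negz k); rewrite raddf0.
  by apply: pihomog_ne0 (hq (Posz k)).1; apply: contraNneq ne => ->.
Qed.

Definition graded_quot (hg : forall j, exists k : nat, g j \is k.-homog) :
  graded_module K m := GradedModule (quot_part_grading hg).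

End QuotientByIdeal.

Section EdgeIdeal.
Variables (K : fieldType) (n : nat).

(* In K[x_1, .., x_n, y_1, .., y_n], encoded as {mpoly K[n + n]}, the variable
   x_i is 'X_(lshift n i) and y_j is 'X_(rshift n j). *)
Definition xy_gen (ij : 'I_n * 'I_n) : {mpoly K[n + n]} :=
  'X_(lshift n ij.1) * 'X_(rshift n ij.2).

Lemma xy_gen_homog ij : exists k : nat, xy_gen ij \is k.-homog.
Proof. by exists 2%N; apply: (@dhomogM _ _ _ 1 _ 1); rewrite dhomogX /= mdeg1. Qed.

Definition S_mod_I : graded_module K (n + n) := graded_quot xy_gen_homog.

End EdgeIdeal.

(* Main.v *)
(* The Hilbert series of S/I is 2/(1-t)^n - 1.  If (1-t)^r times it has
   nonnegative coefficients, then it is a sum of terms t^a/(1-t)^j with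
   r <= j <= n, hence the Hilbert series of a direct sum of shifted copies of
   S/(X_j, X_(j+1), ...), on which X_0, ..., X_(r-1) is a regular sequence; so
   hdepth(S/I) >= r.  The coefficient in degree d is
   2 C(n-r+d-1, d) - (-1)^d C(r, d), so the condition only concerns even d.  By
   unimodality of the ratio of the two binomials only d close to r - n/2 matters,
   and there the ratio is one of the products in (a)-(d), according to the
   parities of n and of r - floor(n/2). *)
Require Import Defs.
From mathcomp Require Import all_boot all_order all_algebra.
From mathcomp Require Import mpoly.
From mathcomp Require Import zify lra.
From mathcomp Require Import boolp classical_sets reals constructive_ereal ereal exp.

Set Implicit Arguments.
Unset Strict Implicit.
Unset Printing Implicit Defensive.

Import Order.TTheory GRing.Theory Num.Theory.
Local Open Scope ring_scope.

(** * Binomial inequalities: unimodality in [d], and ratios as products *)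

(* The coefficient of t^d in 1 / (1 - t)^j; for j = 0 the truncated predecessor
   still gives the right value [d == 0]. *)
Definition multichoose (j d : nat) : nat := 'C((j + d).-1, d).

Lemma multichoose0n d : multichoose 0 d = (d == 0)%N.
Proof. by case: d => [|d] //; rewrite /multichoose bin_small. Qed.

Lemma multichoosen0 j : multichoose j 0 = 1%N.
Proof. by rewrite /multichoose bin0. Qed.

Lemma multichooseS j d :
  multichoose j.+1 d.+1 = (multichoose j d.+1 + multichoose j.+1 d)%N.
Proof. by rewrite /multichoose !addnS !addSn /= binS. Qed.

Lemma mul_multichooseS j d :
  (d.+1 * multichoose j d.+1 = (j + d) * multichoose j d)%N.
Proof.
rewrite /multichoose addnS /= -mul_bin_diag.
by case: (j + d)%N.
Qed.

(* The ratio of consecutive values of 'C(r, d) / multichoose N d is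
   (r - d) / (N + d), so the quotient is unimodal in d, with its maximum near
   d = (r - N) / 2. *)
Lemma bin_le_up r N c d0 d :
  ('C(r, d0) <= c * multichoose N d0)%N -> (r <= N + 2 * d0)%N -> (d0 <= d)%N ->
  ('C(r, d) <= c * multichoose N d)%N.
Proof.
move=> h hr /subnKC <-; elim: (d - d0)%N => [|e IH]; first by rewrite addn0.
rewrite addnS -(leq_pmul2l (ltn0Sn (d0 + e))) mul_bin_left mulnCA mul_multichooseS mulnCA.
by apply: leq_mul => //; lia.
Qed.

(** A step from [d + 1] down to [d] needs [(r - d) / (N + d) >= 1], that is [N + 2 * d <= r]; the
    largest [d] reached this way is [d0 - 1], whence the [+ 2]. *)
Lemma bin_le_down r N c d0 d :
  ('C(r, d0) <= c * multichoose N d0)%N -> (0 < N)%N -> (N + 2 * d0 <= r + 2)%N ->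
  (d <= d0)%N -> ('C(r, d) <= c * multichoose N d)%N.
Proof.
move=> + N0 + le; rewrite -(subnKC le); elim: (d0 - d)%N => [|e IH].
  by rewrite addn0.
rewrite addnS => h hr; apply: IH; last by lia.
have rd : (0 < r - (d + e))%N by lia.
rewrite -(leq_pmul2l rd) -mul_bin_left.
move: h; rewrite -(leq_pmul2l (ltn0Sn (d + e))) => /leq_trans; apply.
by rewrite mulnCA mul_multichooseS [leqRHS]mulnCA leq_mul //; apply: leq_mul => //; lia.
Qed.

(** Each factor equals [(A + c - i) / (A - i)], so the product is the quotient of the falling
    factorials of length [d] of [A + c] and [A]. *)
Lemma prod_bin (R : realFieldType) A c d (x : R) : (d <= A)%N -> x = A%:R ->
  \prod_(0 <= i < d) (1 + c%:R / (x - i%:R)) * 'C(A, d)%:R = 'C(A + c, d)%:R :> R.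
Proof.
move=> + ->; elim: d => [|d IH] le; first by rewrite big_geq // !bin0 mul1r.
have d0 : (d.+1%:R : R) != 0 by rewrite pnatr_eq0.
apply: (mulfI d0); rewrite -[in RHS]natrM mul_bin_left big_nat_recr //= natrM.
rewrite -IH ?(ltnW le) //.
have -> : d.+1%:R * (\prod_(0 <= i < d) (1 + c%:R / (A%:R - i%:R)) *
      (1 + c%:R / (A%:R - d%:R)) * 'C(A, d.+1)%:R) =
    \prod_(0 <= i < d) (1 + c%:R / (A%:R - i%:R)) *
      (1 + c%:R / (A%:R - d%:R)) * (d.+1 * 'C(A, d.+1))%:R :> R.
  by rewrite natrM; lra.
rewrite mul_bin_left natrM -natrB ?(ltnW le) //.
have -> : (A + c - d = (A - d) + c)%N by lia.
have nz : ((A - d)%:R : R) != 0 by rewrite pnatr_eq0; lia.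
rewrite natrD; set y := (A - d)%:R in nz *; set P := \prod_(_ <= _ < _) _.
by rewrite -[y + _](_ : (1 + c%:R / y) * y = _); [lra | rewrite mulrDl mul1r divfK].
Qed.

(** With [A = N + d - 1], [multichoose N d] is ['C(A, d)] and the factor at [j] has denominator
    [k - j = A - (j - j0)]. The offset [j0] serves products that start at 0, 1 or 2. *)
Lemma bin_le_of_prod (R : realFieldType) N c d j0 (k : int) :
  (0 < N)%N -> k = (N + d + j0)%:Z - 1 ->
  \prod_(j0 <= j < j0 + d) (1 + c%:R / (k%:~R - j%:R)) <= 2 :> R ->
  ('C((N + d).-1 + c, d) <= 2 * multichoose N d)%N.
Proof.
move=> N0 -> h; rewrite -(ler_nat R) natrM /multichoose.
rewrite -(@prod_bin R (N + d).-1 c d (N + d).-1%:R) //; last by lia.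
apply: ler_wpM2r; first exact: ler0n.
apply: le_trans h; have -> : \prod_(j0 <= j < j0 + d) (1 + c%:R / (((N + d + j0)%:Z - 1)%:~R - j%:R)) =
    \prod_(0 <= i < d) (1 + c%:R / (((N + d + j0)%:Z - 1)%:~R - (i + j0)%:R)) :> R.
    by rewrite -[X in \prod_(X <= _ < _) _]add0n big_addn addKn.
rewrite le_eqVlt; apply/orP; left; apply/eqP; apply: eq_bigr => i _.
congr (1 + _ / _).
have -> : ((N + d + j0)%:Z - 1)%:~R = ((N + d).-1)%:R + j0%:R :> R.
  rewrite -natrD -[RHS]/((((N + d).-1 + j0)%N : int)%:~R); congr (_%:~R); lia.
by rewrite natrD; lra.
Qed.

Lemma bin_le_multichoose r N d : (0 < N)%N -> (r <= N)%N ->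
  ('C(r, d) <= multichoose N d)%N.
Proof.
by case: d => [|d] N0 rN; rewrite ?multichoosen0 ?bin0 // leq_bin2l //; lia.
Qed.

(** * From the four product hypotheses to binomial inequalities *)

Lemma ln2_le1 (R : realType) : ln 2 <= 1 :> R.
Proof. by have -> : 2 = 1 + 1 :> R by []; apply: le_ln1Dx; lra. Qed.

Lemma ln2_gt0 (R : realType) : 0 < ln 2 :> R.
Proof. by apply: ln_gt0; lra. Qed.

Lemma sqr_le_of_le_sqrt (R : rcfType) (x y : R) :
  0 < x -> x <= Num.sqrt y -> x ^+ 2 <= y.
Proof.
move=> x0 xy; have y0 : 0 < y by rewrite -sqrtr_gt0 (lt_le_trans x0 xy).
by rewrite -[leRHS](@sqr_sqrtr _ y) ?(ltW y0) // lerXn2r ?nnegrE ?sqrtr_ge0 ?(ltW x0).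
Qed.

Section Numerics.
Variable R : realType.

(** Case [n = 2 * k]. With [r = k + e] and [N = k - e] the ratio of the binomials peaks at [d = e],
    where it is the product of the first or the second hypothesis, according to the parity of
    [e]. *)
Lemma bin_le_even (k r : nat) :
  (forall s : nat, (0 < s)%N -> forall k : int,
     ((2 * s)%:R + 1 / 2) ^+ 2 / ln 2 <= k%:~R :> R ->
     \prod_(1 <= j < (2 * s).+1) (1 + (2 * s + 1)%:R / (k%:~R - j%:R)) <= 2 :> R) ->
  (forall s : nat, (0 < s)%N -> forall k : int,
     ((2 * s)%:R + 3 / 2) ^+ 2 / ln 2 <= k%:~R :> R ->
     \prod_(1 <= j < (2 * s + 1).+1) (1 + (2 * s + 2)%:R / (k%:~R - j%:R)) <= 2 :> R) ->
  (0 < k)%N -> r%:R <= k%:R - 1 / 2 + Num.sqrt (k%:R * ln 2) :> R ->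
  (r < 2 * k)%N /\
  forall d, ('C(r, d) <= 2 * multichoose (2 * k - r) d)%N.
Proof.
move=> ha hb k0 hr; have [rk|kr] := leqP r k.
  split=> [|d]; first by lia.
  by apply: leq_trans (leq_pmull _ _) => //; apply: bin_le_multichoose; lia.
have [e e0 re] : exists2 e, (0 < e)%N & r = (k + e)%N by exists (r - k)%N; lia.
(* The bound on [r] says that [e + 1/2] is at most the square root of [k ln 2], which is the range
   required by the first two hypotheses. *)
have he : (e%:R + 1 / 2) ^+ 2 <= k%:R * ln 2 :> R.
  apply: sqr_le_of_le_sqrt; first by have := ler0n R e; lra.
  by move: hr; rewrite re natrD; lra.
have l0 := ln2_gt0 R.
(* As [ln 2 <= 1], this yields [e < k], so that [N] is positive. *)
have hek : (e%:R + 1 / 2) ^+ 2 <= k%:R :> R.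
  by apply: le_trans he _; rewrite ler_piMr ?ln2_le1.
have ek : (4 * e ^ 2 + 4 * e + 1 <= 4 * k)%N.
  by rewrite -(ler_nat R) !natrD !natrM; lra.
have e1 : (e < k)%N by nia.
have Es := odd_double_half e; set s := e./2 in Es.
split=> [|d]; first by lia.
case: (odd e) Es => /= Es.
  suff h : ('C(r, 2 * s + 1) <= 2 * multichoose (2 * k - r) (2 * s + 1))%N.
    case: (leqP (2 * s + 1) d) => hd; last apply: (bin_le_down h); try lia.
    by apply: (bin_le_up h); lia.
  (* The hypotheses concern positive [s], so [e = 1] is treated by hand: the claim is
     [k + 1 <= 2 * (k - 1)], and [ek] gives [k >= 3]. *)
  have [s0|s0] := posnP s.
    by rewrite s0 bin1 /multichoose muln0 add0n addn1 bin1 /=; lia.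
  have := hb s s0 k%:Z; rewrite ler_pdivrMr //.
  have -> : (2 * s)%:R + 3 / 2 = e%:R + 1 / 2 :> R by rewrite -Es natrD -muln2 mulnC; lra.
  move=> /(_ he) /(@bin_le_of_prod R (2 * k - r)).
  have -> : ((2 * k - r + (2 * s + 1)).-1 + (2 * s + 2))%N = r by lia.
  by apply; lia.
suff h : ('C(r, 2 * s) <= 2 * multichoose (2 * k - r) (2 * s))%N.
  case: (leqP (2 * s) d) => hd; last apply: (bin_le_down h); try lia.
  by apply: (bin_le_up h); lia.
have s0 : (0 < s)%N by lia.
have := ha s s0 k%:Z; rewrite ler_pdivrMr //.
have -> : (2 * s)%:R + 1 / 2 = e%:R + 1 / 2 :> R by rewrite -Es -muln2 mulnC.
move=> /(_ he) /(@bin_le_of_prod R (2 * k - r)).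
have -> : ((2 * k - r + 2 * s).-1 + (2 * s + 1))%N = r by lia.
by apply; lia.
Qed.

(** Case [n = 2 * k + 1]. With [r = k + e] and [N = k + 1 - e] the peak is again at [d = e]. For
    even [e] the third hypothesis bounds it; for odd [e] the even degrees closest to the peak are
    [e - 1] and [e + 1], and the fourth hypothesis bounds the ratio there. *)
Lemma bin_le_odd (k r d : nat) :
  (forall s : nat, (0 < s)%N -> forall k : int,
     (4 * s ^ 2)%:R / ln 2 <= k%:~R :> R ->
     \prod_(0 <= j < (2 * s - 1).+1) (1 + (2 * s)%:R / (k%:~R - j%:R)) <= 2 :> R) ->
  (forall s : nat, (0 < s)%N -> forall k : int,
     (2 * s + 1)%:R ^+ 2 / ln 2 <= k%:~R :> R ->
     \prod_(2 <= j < (2 * s + 1).+1) (1 + (2 * s + 2)%:R / (k%:~R - j%:R)) <= 2 :> R) ->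
  r%:R <= k%:R + Num.sqrt (k%:R * ln 2) :> R ->
  (r < (2 * k).+1)%N /\
  (~~ odd d -> ('C(r, d) <= 2 * multichoose ((2 * k).+1 - r) d)%N).
Proof.
move=> hc hd hr; have [rk|kr] := leqP r k.
  split=> [|_]; first by lia.
  by apply: leq_trans (leq_pmull _ _) => //; apply: bin_le_multichoose; lia.
have [e e0 re] : exists2 e, (0 < e)%N & r = (k + e)%N by exists (r - k)%N; lia.
have he : e%:R ^+ 2 <= k%:R * ln 2 :> R.
  apply: sqr_le_of_le_sqrt; first by rewrite ltr0n.
  by move: hr; rewrite re natrD; lra.
have l0 := ln2_gt0 R.
have ek : (e ^ 2 <= k)%N.
  by rewrite -(ler_nat R) natrX; apply: le_trans he _; rewrite ler_piMr ?ln2_le1.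
have e1 : (e <= k)%N by nia.
have Es := odd_double_half e; set s := e./2 in Es.
split=> [|ev]; first by lia.
case: (odd e) Es => /= Es.
  suff h : ('C(r, 2 * s) <= 2 * multichoose ((2 * k).+1 - r) (2 * s))%N.
    case: (leqP d (2 * s)) => hds; first by apply: (bin_le_down h); lia.
    have ed : (2 * s + 2 <= d)%N.
      by have := odd_double_half d; rewrite (negPf ev) /=; lia.
    (* The ratio at [e + 1] equals that at [e - 1]: it is multiplied by [(k + 1) / k] on the way to
       [e], then by [k / (k + 1)]. *)
    apply: (@bin_le_up _ _ _ (2 * s + 2)) => //; last by lia.
    rewrite -(@leq_pmul2l ((2 * s).+2 * (2 * s).+1)) // addn2.
    have -> : ((2 * s).+2 * (2 * s).+1 * 'C(r, (2 * s).+2) = k * k.+1 * 'C(r, 2 * s))%N.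
      rewrite mulnAC mul_bin_left mulnAC -mulnA mul_bin_left mulnA.
      by congr (_ * _ * _)%N; lia.
    have -> : ((2 * s).+2 * (2 * s).+1 * (2 * multichoose ((2 * k).+1 - r) (2 * s).+2) =
               k * k.+1 * (2 * multichoose ((2 * k).+1 - r) (2 * s)))%N.
      rewrite ![(_ * (2 * _))%N]mulnCA; congr (2 * _)%N.
      rewrite mulnAC mul_multichooseS mulnAC -mulnA mul_multichooseS mulnA mulnC.
      by rewrite [RHS]mulnC; congr (_ * _)%N; rewrite mulnC; congr (_ * _)%N; lia.
    by rewrite leq_mul2l h orbT.
  have [->|s0] := posnP s; first by rewrite bin0 multichoosen0.
  (* The hypothesis is taken at [k + 1]: its product starts at [j = 2], so the denominators run down
     from [k - 1 = N + 2 * s - 1]. *)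
  have := hd s s0 (k.+1)%:Z; rewrite ler_pdivrMr //.
  have -> : (2 * s + 1)%:R = e%:R :> R by rewrite -Es -muln2 mulnC addnC.
  have he' : e%:R ^+ 2 <= (k.+1%:Z)%:~R * ln 2 :> R.
    by apply: le_trans he _; rewrite ler_wpM2r ?(ltW l0) // ler_nat.
  move=> /(_ he'); have -> : (2 * s + 1).+1 = (2 + 2 * s)%N by lia.
  move=> /(@bin_le_of_prod R ((2 * k).+1 - r)).
  have -> : (((2 * k).+1 - r + 2 * s).-1 + (2 * s + 2))%N = r by lia.
  by apply; lia.
suff h : ('C(r, 2 * s) <= 2 * multichoose ((2 * k).+1 - r) (2 * s))%N.
  case: (leqP (2 * s) d) => hd'; last apply: (bin_le_down h); try lia.
  by apply: (bin_le_up h); lia.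
have s0 : (0 < s)%N by lia.
have := hc s s0 k%:Z; rewrite ler_pdivrMr //.
have -> : (4 * s ^ 2)%:R = e%:R ^+ 2 :> R by rewrite -natrX -Es; congr (_%:R); lia.
move=> /(_ he); have -> : (2 * s - 1).+1 = (0 + 2 * s)%N by lia.
move=> /(@bin_le_of_prod R ((2 * k).+1 - r)).
have -> : (((2 * k).+1 - r + 2 * s).-1 + 2 * s)%N = r by lia.
by apply; lia.
Qed.

Lemma floor_sqrt_bound (n : nat) : (0 < n)%N ->
  exists r : nat, Num.floor ((n%:R - 1) / 2 + Num.sqrt ((n %/ 2)%:R * ln 2) : R) = r%:Z
    /\ r%:R <= (n%:R - 1) / 2 + Num.sqrt ((n %/ 2)%:R * ln 2) :> R.
Proof.
move=> n0; set x : R := _ + _.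
have x0 : 0 <= x.
  rewrite addr_ge0 ?sqrtr_ge0 // divr_ge0 // subr_ge0.
  by rewrite (ler_nat R 1 n).
have := floor_ge0 x; rewrite x0; case Er : (Num.floor x) => [r|//] _.
exists r; split=> //; have := floor_le_tmp x; rewrite Er.
by [].
Qed.

End Numerics.

(** * Writing 2/(1-t)^n - 1 as a sum of terms t^a/(1-t)^j *)

(* The coefficient of t^d in t^a / (1 - t)^j. *)
Definition shift_coef (j a d : nat) : nat :=
  if (a <= d)%N then multichoose j (d - a) else 0%N.

Lemma shift_coef0 j d : shift_coef j 0 d = multichoose j d.
Proof. by rewrite /shift_coef subn0. Qed.

Lemma shift_coefSj j a d :
  shift_coef j.+1 a d = (shift_coef j a d + shift_coef j.+1 a.+1 d)%N.
Proof.
rewrite /shift_coef; case: (ltngtP a d) => [lt|//|->].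
  by rewrite -(subnSK lt) multichooseS.
by rewrite subnn !multichoosen0.
Qed.

(* Repeated use of t^a/(1-t)^(j+1) = t^a/(1-t)^j + t^(a+1)/(1-t)^(j+1), cut off
   after D terms. *)
Lemma shift_coef_expand r i D a :
  exists2 L : seq (nat * nat), all (fun ja => r <= ja.1 <= r + i)%N L &
  forall d, shift_coef (r + i) a d =
    (\sum_(0 <= k < D) multichoose i k * shift_coef r (a + k) d +
     \sum_(ja <- L) shift_coef ja.1 ja.2 d)%N.
Proof.
elim: i D a => [|i IHi] D a.
  case: D => [|D].
    exists [:: (r, a)] => [|d]; first by rewrite /= addn0 leqnn.
    by rewrite big_geq // big_seq1 addn0.
  exists [::] => // d; rewrite big_nil big_nat_recl //= big1 => [|k _].
    by rewrite multichoose0n mul1n !addn0.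
  by rewrite multichoose0n.
elim: D a => [|D IHD] a.
  exists [:: (r + i.+1, a)%N] => [|d]; first by rewrite /= leqnn leq_addr.
  by rewrite big_geq // big_seq1.
(* One splitting of t^a/(1-t)^(r+i+1): the summand with the smaller exponent is expanded by the
   outer induction with [D + 1] terms, the one with [a + 1] by the inner induction, and Pascal's
   rule merges the coefficients. *)
have [L1 L1r hL1] := IHi D.+1 a; have [L2 L2r hL2] := IHD a.+1.
exists (L1 ++ L2) => [|d].
  rewrite all_cat L2r andbT; apply: sub_all L1r => -[j b] /=; lia.
rewrite addnS shift_coefSj hL1 -addnS hL2 big_cat /= addnACA; congr (_ + _)%N.
rewrite !big_nat_recl // -addnA; congr (_ + _)%N; first by rewrite !multichoosen0.
rewrite -big_split /=; apply: eq_bigr => k _.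
by rewrite addnS addSn -mulnDl -multichooseS.
Qed.

(* The expansion of 1 as (1 - t)^r / (1 - t)^r. *)
Lemma alternating_shift_coef r d :
  \sum_(0 <= k < r.+1) (-1) ^+ k * ('C(r, k) * shift_coef r k d)%:Z = (d == 0)%N%:Z.
Proof.
have -> : (d == 0)%N%:Z = (shift_coef 0 0 d)%:Z by rewrite shift_coef0 multichoose0n.
elim: r => [|r IH].
  by rewrite big_nat1 expr0 mul1r bin0 mul1n.
rewrite -IH {IH}.
have E k : (shift_coef r k d)%:Z = (shift_coef r.+1 k d)%:Z - (shift_coef r.+1 k.+1 d)%:Z.
  by rewrite (shift_coefSj r k); lia.
under [RHS]eq_bigr do rewrite PoszM E mulrBr mulrBr.
rewrite sumrB big_nat_recl // [X in X - _]big_nat_recl // !bin0 -addrA; congr (_ + _).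
rewrite [X in _ = X - _](_ : _ = \sum_(0 <= i < r.+1)
  (-1) ^+ i.+1 * ('C(r, i.+1)%:Z * (shift_coef r.+1 i.+1 d)%:Z)); last first.
  by rewrite big_nat_recr //= bin_small // mul0r mulr0 addr0.
rewrite -sumrB; apply: eq_bigr => k _.
by rewrite binS PoszM PoszD exprS; lia.
Qed.

(* Multiplying the Hilbert series 2 / (1 - t)^n - 1 by (1 - t)^r gives
   2 / (1 - t)^(n - r) - (1 - t)^r, whose coefficients are nonnegative. *)
Lemma hilbert_decomposition n r : (r <= n)%N ->
  (forall k, ~~ odd k -> 'C(r, k) <= 2 * multichoose (n - r) k)%N ->
  exists2 L : seq (nat * nat), all (fun ja => r <= ja.1 <= n)%N L &
  forall d, (\sum_(ja <- L) shift_coef ja.1 ja.2 d = 2 * multichoose n d - (d == 0))%N.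
Proof.
(* The cut-off at [r + 1] terms keeps the t^k/(1-t)^r with [k <= r], exactly those occurring in 1 =
   (1-t)^r/(1-t)^r; subtracting 1 changes only these. *)
move=> rn hC; have [L Lr hL] := shift_coef_expand r (n - r) r.+1 0.
have [c hc] : exists c : nat -> nat, forall k,
    (c k)%:Z = (2 * multichoose (n - r) k)%:Z - (-1) ^+ k * 'C(r, k)%:Z.
  (* For odd [k] the subtraction of a negative coefficient adds ['C(r, k)]; for even [k], [hC] makes
     the truncated subtraction exact. *)
  exists (fun k => if odd k then 2 * multichoose (n - r) k + 'C(r, k)
                   else 2 * multichoose (n - r) k - 'C(r, k))%N => k.
  rewrite -signr_odd; have := hC k; case: (odd k) => /= [_|/(_ isT)]; lia.
(* The remainder [L] occurs twice because of the factor 2 in 2/(1-t)^n. *)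
exists (flatten [seq nseq (c k) (r, k) | k <- iota 0 r.+1] ++ L ++ L) => [|d].
  rewrite subnKC // in Lr; rewrite all_cat; apply/andP; split; last by rewrite all_cat Lr.
  by apply/allP => _ /flatten_mapP[k _ /nseqP[-> _]] /=; rewrite leqnn.
have hd : multichoose n d =
    (\sum_(0 <= k < r.+1) multichoose (n - r) k * shift_coef r k d +
     \sum_(ja <- L) shift_coef ja.1 ja.2 d)%N.
  by rewrite -shift_coef0 -[in LHS](subnKC rn) hL.
have E : (\sum_(ja <- flatten [seq nseq (c k) (r, k) | k <- iota 0 r.+1])
    shift_coef ja.1 ja.2 d = \sum_(0 <= k < r.+1) c k * shift_coef r k d)%N.
  rewrite big_flatten big_map /index_iota subn0; apply: eq_bigr => k _.
  by rewrite big_nseq iter_addn_0 mulnC.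
rewrite big_cat E big_cat /= hd.
suff h : (\sum_(0 <= k < r.+1) c k * shift_coef r k d)%N%:Z =
   2 * (\sum_(0 <= k < r.+1) multichoose (n - r) k * shift_coef r k d)%N%:Z - (d == 0)%N%:Z.
  by move: h; lia.
rewrite -(alternating_shift_coef r d).
rewrite !(big_morph Posz PoszD (erefl (Posz 0))) mulr_sumr -sumrB.
by apply: eq_bigr => k _; rewrite !PoszM hc; lia.
Qed.

(** * Dimensions of graded parts and sums of homogeneous components *)

Section HilbertFunction.
Variables (K : fieldType) (m : nat) (M : graded_module K m).

(** Expressing each basis in the other gives matrices with [mP *m mQ = 1], by uniqueness of
    coordinates, and this forces [k <= l]. *)
Lemma K_basis_leq (A : set M) k l (b : 'I_k -> M) (b' : 'I_l -> M) :
  K_basis A b -> K_basis A b' -> (k <= l)%N.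
Proof.
move=> [Ab hb] [Ab' hb'].
have /choice[P hP] i : exists c : {ffun 'I_l -> K}, b i = \sum_j (c j)%:MP *: b' j.
  by have [c [-> _]] := hb' _ (Ab i); exists c.
have /choice[Q hQ] i : exists c : {ffun 'I_k -> K}, b' i = \sum_j (c j)%:MP *: b j.
  by have [c [-> _]] := hb _ (Ab' i); exists c.
pose mP := \matrix_(i, j) P i j; pose mQ := \matrix_(i, j) Q i j.
apply: (@mulmx1_min _ _ _ mP mQ); apply/matrixP => i j.
have [c [_ uc]] := hb _ (Ab i).
suff : [ffun j => (mP *m mQ) i j] = [ffun j => (i == j)%:R].
  by move=> /ffunP/(_ j); rewrite !ffunE => ->; rewrite [RHS]mxE.
transitivity c; [symmetry; apply: uc|apply: uc]; last first.
  rewrite (bigD1 i) //= ffunE eqxx scale1r big1 ?addr0 // => a ne.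
  by rewrite ffunE eq_sym (negPf ne) scale0r.
under eq_bigr => a _ do rewrite ffunE mxE raddf_sum scaler_suml.
rewrite exchange_big /= hP; apply: eq_bigr => a _.
rewrite hQ scaler_sumr; apply: eq_bigr => e _.
by rewrite scalerA !mxE mpolyCM.
Qed.

Lemma hilbert_functionE d k (b : 'I_k -> M) :
  K_basis (@gm_part K m M d) b -> hilbert_function M d = k.
Proof.
move=> hb; rewrite /hilbert_function; case: xgetP => [x _ [b' hb']|/(_ k)[]].
  by apply/eqP; rewrite eqn_leq (K_basis_leq hb hb') (K_basis_leq hb' hb).
by exists b.
Qed.

End HilbertFunction.

Section Grading.
Variables (K : fieldType) (m : nat) (M : lmodType {mpoly K[m]}).
Variables (gr : int -> set M) (hgr : is_grading gr).

Lemma grD d u v : gr d u -> gr d v -> gr d (u + v).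
Proof.
move=> gu gv; rewrite -[v]opprK; apply: (gr_sub hgr) => //.
by rewrite -sub0r; apply: (gr_sub hgr) => //; apply: (gr_zero hgr).
Qed.

Lemma gr_sum_uniq v : exists (s : seq int) (f : int -> M),
  [/\ uniq s, forall d, gr d (f d), forall d, d \notin s -> f d = 0 &
      v = \sum_(d <- s) f d].
Proof.
have [s [f [hf ->]]] := gr_sum hgr v.
exists (undup s), (fun d => f d *+ count_mem d s); split.
- exact: undup_uniq.
- move=> d; elim: (count_mem d s) => [|k IH]; first exact: (gr_zero hgr).
  by rewrite mulrS; apply: grD.
- by move=> d; rewrite mem_undup => /count_memPn ->.
- by rewrite -big_undup_iterop_count.
Qed.

Lemma sum_superset (s s' : seq int) (f : int -> M) :
  uniq s -> uniq s' -> {subset s <= s'} -> (forall d, d \notin s -> f d = 0) ->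
  \sum_(d <- s) f d = \sum_(d <- s') f d.
Proof.
move=> us us' ss h0; rewrite [RHS](bigID (mem s)) /= [X in _ + X]big1 // addr0.
rewrite -[RHS]big_filter; apply: perm_big; apply: uniq_perm => //.
  by rewrite filter_uniq.
by move=> d; rewrite mem_filter; case: (boolP (d \in s)) => //= /ss ->.
Qed.

End Grading.

Lemma split_lshift m n (i : 'I_m) : split (lshift n i) = inl i.
Proof. exact: (unsplitK (inl i)). Qed.

Lemma split_rshift m n (i : 'I_n) : split (rshift m i) = inr i.
Proof. exact: (unsplitK (inr i)). Qed.

(** * Direct sums and shifts of graded modules *)

Section Product.
Variables (K : fieldType) (m : nat) (M1 M2 : graded_module K m).

Definition prod_part (d : int) : set (M1 * M2)%type :=
  [set u | @gm_part K m M1 d u.1 /\ @gm_part K m M2 d u.2].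

Lemma sum_pair I (s : seq I) (P : pred I) (f : I -> M1) (g : I -> M2) :
  \sum_(i <- s | P i) (f i, g i) = (\sum_(i <- s | P i) f i, \sum_(i <- s | P i) g i).
Proof. by elim/big_rec3: _ => // i x y _ _ ->. Qed.

Lemma sum_pair_eta I (s : seq I) (P : pred I) (f : I -> M1 * M2) :
  \sum_(i <- s | P i) f i = (\sum_(i <- s | P i) (f i).1, \sum_(i <- s | P i) (f i).2).
Proof. by rewrite -sum_pair; apply: eq_bigr => i _; case: (f i). Qed.

Lemma prod_grading : is_grading prod_part.
Proof.
have h1 := gm_grading M1; have h2 := gm_grading M2; split.
- by move=> d; split; [exact: gr_zero h1 d | exact: gr_zero h2 d].
- by move=> d u v [? ?] [? ?]; split; [exact: gr_sub h1 _ _ _ _ _ | exact: gr_sub h2 _ _ _ _ _].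
- by move=> e d p v hp [? ?]; split; [exact: gr_scale h1 _ _ _ _ _ _ | exact: gr_scale h2 _ _ _ _ _ _].
- move=> [v1 v2].
  have [s1 [f1 [u1 g1 z1 ->]]] := gr_sum_uniq h1 v1.
  have [s2 [f2 [u2 g2 z2 ->]]] := gr_sum_uniq h2 v2.
  exists (undup (s1 ++ s2)), (fun d => (f1 d, f2 d)); split; first by [].
  rewrite sum_pair; congr (_, _); apply: sum_superset => //; try exact: undup_uniq.
    by move=> d ds; rewrite mem_undup mem_cat ds.
  by move=> d ds; rewrite mem_undup mem_cat ds orbT.
- move=> s f us hf; rewrite sum_pair_eta => -[e1 e2] d ds.
  rewrite [f d]surjective_pairing.
  rewrite (@gr_direct _ _ _ _ h1 s (fun d => (f d).1) us (fun d => (hf d).1) e1) //.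
  by rewrite (@gr_direct _ _ _ _ h2 s (fun d => (f d).2) us (fun d => (hf d).2) e2).
Qed.

Definition prod_module : graded_module K m := GradedModule prod_grading.

Lemma prod_K_basis d k l (b1 : 'I_k -> M1) (b2 : 'I_l -> M2) :
  K_basis (@gm_part K m M1 d) b1 -> K_basis (@gm_part K m M2 d) b2 ->
  exists b : 'I_(k + l) -> prod_module, K_basis (@gm_part K m prod_module d) b.
Proof.
move=> [A1 h1] [A2 h2].
pose b i : prod_module := match split i with inl a => (b1 a, 0) | inr a => (0, b2 a) end.
have E (c : {ffun 'I_(k + l) -> K}) : \sum_i (c i)%:MP *: b i =
  (\sum_i (c (lshift l i))%:MP *: b1 i, \sum_i (c (rshift k i))%:MP *: b2 i).
  rewrite big_split_ord /=.
  rewrite (eq_bigr (fun i => ((c (lshift l i))%:MP *: b1 i, 0))); last first.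
    by move=> i _; rewrite /b split_lshift; congr (_, _); rewrite scaler0.
  rewrite [X in _ + X](eq_bigr (fun i => (0, (c (rshift k i))%:MP *: b2 i))); last first.
    by move=> i _; rewrite /b split_rshift; congr (_, _); rewrite scaler0.
  by rewrite !sum_pair !big1_eq; congr (_, _); rewrite ?addr0 ?add0r.
exists b; split=> [i|[v1 v2] [/= Av1 Av2]].
  rewrite /b; case: (split i) => a; split=> //=.
    exact: gr_zero (gm_grading M2) d.
  exact: gr_zero (gm_grading M1) d.
have [c1 [e1 u1]] := h1 _ Av1; have [c2 [e2 u2]] := h2 _ Av2.
exists [ffun i => match split i with inl a => c1 a | inr a => c2 a end]; split.
  rewrite E e1 e2; congr (_, _); apply: eq_bigr => i _; rewrite ffunE.
    by rewrite split_lshift.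
  by rewrite split_rshift.
move=> c; rewrite E => -[e1' e2']; apply/ffunP => i; rewrite ffunE.
case: (split_ordP i) => a ->.
  rewrite (u1 [ffun a => c (lshift l a)]) ?ffunE // e1'.
  by apply: eq_bigr => j _; rewrite ffunE.
rewrite (u2 [ffun a => c (rshift k a)]) ?ffunE // e2'.
by apply: eq_bigr => j _; rewrite ffunE.
Qed.

Lemma prod_finitely_generated :
  finitely_generated M1 -> finitely_generated M2 -> finitely_generated prod_module.
Proof.
move=> [g1 h1] [g2 h2].
pose g := [seq (x, 0) | x <- g1] ++ [seq (0, x) | x <- g2] : seq prod_module.
have sg : size g = (size g1 + size g2)%N by rewrite size_cat !size_map.
exists g => -[v1 v2]; have [c1 ->] := h1 v1; have [c2 ->] := h2 v2.
exists (fun i => match split (cast_ord sg i) with inl a => c1 a | inr a => c2 a end).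
rewrite (reindex (cast_ord (esym sg))) /=; last first.
  by exists (cast_ord sg) => i _; rewrite ?cast_ordK ?cast_ordKV.
rewrite big_split_ord /=.
rewrite (eq_bigr (fun i => (c1 i *: g1`_i, 0))); last first.
  move=> i _; rewrite cast_ordKV split_lshift /g nth_cat size_map ltn_ord.
  by rewrite (nth_map 0) //; congr (_, _); rewrite scaler0.
rewrite [X in _ + X](eq_bigr (fun i => (0, c2 i *: g2`_i))); last first.
  move=> i _; rewrite cast_ordKV split_rshift /g nth_cat size_map /= ltnNge leq_addr /=.
  by rewrite addKn (nth_map 0) //; congr (_, _); rewrite scaler0.
by rewrite !sum_pair !big1_eq; congr (_, _); rewrite ?addr0 ?add0r.
Qed.

Lemma prod_seq_submodule rs (v : prod_module) :
  seq_submodule rs v <-> seq_submodule rs v.1 /\ seq_submodule rs v.2.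
Proof.
split=> [[w ->]|]; last first.
  case: v => v1 v2 /= [[w1 ->] [w2 ->]]; exists (fun i => (w1 i, w2 i)).
  by rewrite -sum_pair.
by rewrite sum_pair_eta; split; [exists (fun i => (w i).1) | exists (fun i => (w i).2)].
Qed.

(** The submodules generated by initial segments of [rs] split componentwise, and [(v1, 0)]
    witnesses properness. *)
Lemma prod_regular_sequence rs :
  regular_sequence M1 rs -> regular_sequence M2 rs -> regular_sequence prod_module rs.
Proof.
move=> [r1 [v1 n1]] [r2 _]; split=> [i v le|].
  by rewrite !prod_seq_submodule => -[] /(r1 _ _ le) ? /(r2 _ _ le) ?.
by exists (v1, 0); rewrite prod_seq_submodule => -[].
Qed.

End Product.

Section Shift.
Variables (K : fieldType) (m : nat) (M : graded_module K m) (a : int).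

(** This is M(-a): the Hilbert series is multiplied by t^a, while the underlying module, hence
    finite generation and regular sequences, stays the same. *)
Definition shift_part (d : int) : set M := @gm_part K m M (d - a).

Lemma shift_grading : is_grading shift_part.
Proof.
have h := gm_grading M; split.
- by move=> d; apply: gr_zero h _.
- by move=> d u v; apply: gr_sub h _ _ _.
- by move=> e d p v hp hv; rewrite /shift_part -addrA; apply: gr_scale h _ _ _ _ hp hv.
- move=> v; have [s [f [hf ->]]] := gr_sum h v.
  exists [seq d + a | d <- s], (fun d => f (d - a)); split; first by move=> d; apply: hf.
  by rewrite big_map; apply: eq_bigr => d _; rewrite addrK.
- move=> s f us hf e d ds.
  have := @gr_direct _ _ _ _ h [seq d - a | d <- s] (fun d => f (d + a)).
  rewrite big_map (eq_bigr f) => [|i _]; last by rewrite subrK.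
  rewrite map_inj_uniq; last exact: addIr.
  have hf' d' : @gm_part K m M d' (f (d' + a)).
    by have := hf (d' + a); rewrite /shift_part addrK.
  by move=> /(_ us hf' e (d - a) (map_f _ ds)); rewrite subrK.
Qed.

Definition shift_module : graded_module K m := GradedModule shift_grading.

End Shift.

(** * Quotients by monomial ideals and their bases of standard monomials *)

Section MonomialQuotient.
Variables (K : fieldType) (m : nat) (J : finType).
Variables (g : J -> {mpoly K[m]}) (u : J -> 'X_{1..m}).
Hypothesis gE : forall j, g j = 'X_[u j].
Hypothesis g_homog : forall j, exists k : nat, g j \is k.-homog.

Definition in_monomial_ideal (a : 'X_{1..m}) : bool := [exists j, (u j <= a)%MM].

(** Multiples of a generator have all their monomials in the ideal; conversely, each term of such a
    [p] is a multiple of a generator. *)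
Lemma gen_ideal_monomialP p :
  reflect {in msupp p, forall a, in_monomial_ideal a} (p \in gen_ideal g).
Proof.
apply: (iffP idP) => [/gen_idealP[c ->] a|h].
  move=> /msupp_sum_le/flatten_mapP[j _]; rewrite gE (perm_mem (msuppMX _ _)).
  by move=> /mapP[b _ ->]; apply/existsP; exists j; rewrite lem_addr.
rewrite (mpolyE p) big_seq rpred_sum // => a /h/existsP[j ja].
by rewrite -(submK ja) mpolyXD -mul_mpolyC mulrA -gE gen_ideal_gen.
Qed.

Lemma scale_quot_proj p q : p *: quot_proj g q = quot_proj g (p * q).
Proof. exact: quot_scaleE. Qed.

Section Basis.
Variables (s : seq 'X_{1..m}) (e : nat).
Hypothesis us : uniq s.
Hypothesis mem_s : forall a, (a \in s) = (mdeg a == e) && ~~ in_monomial_ideal a.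

Let comb (c : {ffun 'I_(size s) -> K}) : {mpoly K[m]} :=
  \sum_i (c i)%:MP * 'X_[nth 0%MM s i].

Let mcoeff_comb c (i : 'I_(size s)) : (comb c)@_(nth 0%MM s i) = c i.
Proof.
rewrite raddf_sum (bigD1 i) //= mcoeffCM mcoeffX eqxx mulr1 big1 ?addr0 // => k ne.
by rewrite mcoeffCM mcoeffX nth_uniq // (inj_eq val_inj) (negPf ne) mulr0.
Qed.

Let mcoeff_comb0 c a : a \notin s -> (comb c)@_a = 0.
Proof.
move=> na; rewrite raddf_sum big1 // => k _ /=.
rewrite mcoeffCM mcoeffX; case: eqP => [E|_]; last by rewrite mulr0.
by rewrite -E mem_nth in na.
Qed.

(** The list [s] consists of the standard monomials of degree [e]. A homogeneous [p] agrees modulo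
    the ideal with its part on [s], and a combination of members of [s] lies in the ideal only if it
    is 0. *)
Lemma quot_K_basis :
  K_basis (@gm_part K m (graded_quot g_homog) e%:Z)
    (fun i : 'I_(size s) => quot_proj g 'X_[nth 0%MM s i]).
Proof.
have combE (c : {ffun 'I_(size s) -> K}) :
    \sum_i (c i)%:MP *: quot_proj g 'X_[nth 0%MM s i] = quot_proj g (comb c).
  by rewrite raddf_sum; apply: eq_bigr => i _; rewrite scale_quot_proj.
split=> [i|v [p hp ->]].
  exists 'X_[nth 0%MM s i] => //.
  rewrite dhomogX /=; have : nth 0%MM s i \in s by rewrite mem_nth.
  by rewrite mem_s => /andP[].
exists [ffun i : 'I_(size s) => p@_(nth 0%MM s i)]; split=> [|c].
  rewrite combE; apply/quot_proj_eq/gen_ideal_monomialP => a.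
  rewrite mcoeff_msupp mcoeffB; have [|na] := boolP (a \in s).
    move=> /(nthP 0%MM)[i lt <-]; rewrite -[i]/(nat_of_ord (Ordinal lt)) mcoeff_comb.
    by rewrite ffunE subrr eqxx.
  rewrite mcoeff_comb0 // subr0 -mcoeff_msupp => /(dhomogP _ _ _ hp) /= da.
  by move: na; rewrite mem_s da eqxx negbK.
rewrite combE => /quot_proj_eq/gen_ideal_monomialP h; apply/ffunP => i; rewrite ffunE.
apply/eqP; rewrite -subr_eq0 -(mcoeff_comb c i) -mcoeffB mcoeff_eq0.
apply/negP => /h; have : nth 0%MM s i \in s by rewrite mem_nth.
by rewrite mem_s => /andP[_ /negPf ->].
Qed.

End Basis.

Lemma quot_K_basis_neg e (b : 'I_0 -> graded_quot g_homog) :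
  K_basis (@gm_part K m (graded_quot g_homog) (Negz e)) b.
Proof.
split=> [[]//|v [p /eqP-> ->]]; exists [ffun=> 0]; split.
  by rewrite big_ord0 raddf0.
by move=> c _; apply/ffunP => -[].
Qed.

Lemma quot_finitely_generated : finitely_generated (graded_quot g_homog).
Proof.
exists [:: (quot_proj g 1 : graded_quot g_homog)] => v; have [p ->] := quot_projP v.
by exists (fun=> p); rewrite big_ord1 /= scale_quot_proj mulr1.
Qed.

End MonomialQuotient.

(** * Counting the monomials of degree [e] in [j] of the variables *)

Section CountMonomials.
Variables (j m : nat) (f : 'I_j -> 'I_m).
Hypothesis f_inj : injective f.

(** The exponents in [t] are placed on the variables [f k]; for injective [f] the sum has at most
    one term, and it avoids inverting [f]. In degree [e] no exponent exceeds [e], so the finite type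
    of tuples suffices. *)
Definition push_mnm e (t : j.-tuple 'I_e.+1) : 'X_{1..m} :=
  [multinom (\sum_(k < j | f k == i) tnth t k)%N | i < m].

Lemma push_mnmE e (t : j.-tuple 'I_e.+1) k : push_mnm t (f k) = tnth t k.
Proof.
rewrite mnmE (bigD1 k) //= big1 ?addn0 // => l /andP[/eqP/f_inj-> ].
by rewrite eqxx.
Qed.

Lemma push_mnm0 e (t : j.-tuple 'I_e.+1) i : i \notin codom f -> push_mnm t i = 0%N.
Proof.
move=> ni; rewrite mnmE big1 // => k /eqP E.
by rewrite -E codom_f in ni.
Qed.

Lemma push_mnm_inj e : injective (@push_mnm e).
Proof.
move=> t t' E; apply: eq_from_tnth => k; apply: val_inj.
by rewrite /= -!push_mnmE E.
Qed.

Lemma mdeg_supported (a : 'X_{1..m}) : (forall i, i \notin codom f -> a i = 0%N) ->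
  mdeg a = (\sum_(k < j) a (f k))%N.
Proof.
move=> h; rewrite mdegE (bigID (mem (codom f))) /= [X in (_ + X)%N]big1 ?addn0 //.
transitivity (\sum_(i <- codom f) a i)%N; last by rewrite big_image.
by rewrite big_uniq // map_inj_uniq ?enum_uniq.
Qed.

Definition monomials_on e : seq 'X_{1..m} :=
  [seq push_mnm t | t in [set t : j.-tuple 'I_e.+1 | (\sum_(i <- t) i)%N == e]].

Lemma mem_monomials_on e a :
  (a \in monomials_on e) = (mdeg a == e) && [forall i, (i \notin codom f) ==> (a i == 0%N)].
Proof.
apply/fintype.imageP/andP => [[t /[!inE]/eqP te ->]|[/eqP ae /forall_inP h]].
  split; last by apply/forall_inP => i ni; rewrite push_mnm0.
  rewrite mdeg_supported; last exact: push_mnm0.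
  rewrite -[X in _ == X]te big_tuple; apply/eqP.
  by apply: eq_bigr => k _; rewrite push_mnmE.
have a0 i : i \notin codom f -> a i = 0%N by move=> /h/eqP.
have le k : (a (f k) < e.+1)%N.
  by rewrite ltnS -ae mdegE (bigD1 (f k)) //= leq_addr.
exists [tuple Ordinal (le k) | k < j].
  rewrite inE big_tuple -[X in _ == X]ae mdeg_supported //.
  by apply/eqP; apply: eq_bigr => k _; rewrite tnth_mktuple.
apply/mnmP => i; have [/codomP[k ->]|ni] := boolP (i \in codom f).
  by rewrite push_mnmE tnth_mktuple.
by rewrite push_mnm0 // a0.
Qed.

Lemma monomials_on_uniq e : uniq (monomials_on e).
Proof. by rewrite map_inj_uniq ?enum_uniq //; apply: push_mnm_inj. Qed.

End CountMonomials.

Lemma size_monomials_on j m (f : 'I_j -> 'I_m) e :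
  size (monomials_on f e) = multichoose j e.
Proof.
rewrite size_image; case: j f => [|j] _; last first.
  by rewrite card_ord_partitions /multichoose addSn /= -bin_sub ?leq_addr // addKn.
rewrite multichoose0n; case: e => [|e].
  rewrite (eq_card (B := predT)) ?card_tuple ?expn0 // => t.
  by rewrite !inE tuple0 big_nil.
by apply: eq_card0 => t; rewrite inE tuple0 big_nil.
Qed.

(** * Regular sequences of variables on monomial quotients *)

Section SeqSubmodule.
Variables (K : fieldType) (m : nat) (M : graded_module K m) (rs : seq {mpoly K[m]}).

Lemma seq_submoduleD (v w : M) :
  seq_submodule rs v -> seq_submodule rs w -> seq_submodule rs (v + w).
Proof.
move=> [x ->] [y ->]; exists (fun i => x i + y i).
by rewrite -big_split /=; apply: eq_bigr => i _; rewrite scalerDr.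
Qed.

Lemma seq_submodule0 : seq_submodule rs (0 : M).
Proof. by exists (fun=> 0); rewrite big1 // => i _; rewrite scaler0. Qed.

Lemma seq_submodule_gen p (v : M) : p \in rs -> seq_submodule rs (p *: v).
Proof.
move=> /(nthP 0)[k lt <-]; pose i0 := Ordinal lt.
exists (fun i => if i == i0 then v else 0).
rewrite (bigD1 i0) //= eqxx big1 ?addr0 // => i /negPf ->.
by rewrite scaler0.
Qed.

End SeqSubmodule.

Section MonomialRegular.
Variables (K : fieldType) (m : nat) (J : finType).
Variables (g : J -> {mpoly K[m]}) (u : J -> 'X_{1..m}).
Hypothesis gE : forall j, g j = 'X_[u j].
Hypothesis g_homog : forall j, exists k : nat, g j \is k.-homog.

Let M := graded_quot g_homog.

(** The left side says that [p] lies in the monomial ideal enlarged by the variables in [t], and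
    membership there is decided monomial by monomial. *)
Lemma quot_seq_submoduleP (t : seq 'I_m) p :
  seq_submodule [seq 'X_i | i <- t] (quot_proj g p : M) <->
  {in msupp p, forall a, in_monomial_ideal u a || has (fun i => a i != 0%N) t}.
Proof.
split=> [[w]|h].
  have /choice[q hq] i : exists q, w i = quot_proj g q by apply: quot_projP.
  set rs := [seq 'X_i | i <- t] in w q hq *.
  rewrite (eq_bigr (fun i : 'I_(size rs) => quot_proj g (rs`_i * q i))); last first.
    by move=> i _; rewrite hq; apply: scale_quot_proj.
  rewrite -raddf_sum => /quot_proj_eq/(gen_ideal_monomialP gE) h a.
  rewrite -[p](subrK (\sum_(i < size rs) rs`_i * q i)) => /msuppD_le.
  rewrite mem_cat => /orP[/h -> //|/msupp_sum_le/flatten_mapP[i _]].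
  have lt : (i < size t)%N by rewrite -(size_map (fun i => 'X_i : {mpoly K[m]}) t); apply: ltn_ord.
  have x0 : 'I_m by case: (t) lt => [|x].
  rewrite (nth_map x0) // mulrC (perm_mem (msuppMX _ _)) => /mapP[b _ ->].
  apply/orP; right; apply/hasP; exists (nth x0 t i); first exact: mem_nth.
  by rewrite mnmDE mnm1E eqxx.
rewrite (mpolyE p) raddf_sum /= big_seq.
apply: (big_ind (fun v : M => seq_submodule [seq 'X_i | i <- t] v)).
- exact: seq_submodule0.
- exact: seq_submoduleD.
move=> a /h /orP[aI|/hasP[i it ai]].
  have -> : quot_proj g (p@_a *: 'X_[a]) = 0; last exact: seq_submodule0.
  rewrite -[0](raddf0 (quot_proj g)); apply/quot_proj_eq/(gen_ideal_monomialP gE).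
  by rewrite subr0 => b /msuppZ_le; rewrite msuppX inE => /eqP ->.
have ia : (U_(i) <= a)%MM by rewrite lep1mP.
rewrite -(submK ia) addmC mpolyXD scalerAr -scale_quot_proj.
by apply: seq_submodule_gen; apply: map_f.
Qed.

(** By the second condition, multiplication by a variable of [t] takes no monomial from outside the
    ideal into it. As the variables are distinct, it also creates no divisibility by an earlier
    one. *)
Lemma quot_regular_sequence (t : seq 'I_m) :
  uniq t ->
  (forall i a, i \in t -> in_monomial_ideal u (a + U_(i))%MM -> in_monomial_ideal u a) ->
  ~~ in_monomial_ideal u 0%MM ->
  regular_sequence M [seq 'X_i | i <- t].
Proof.
move=> ut hu h0; split=> [k v|].
  have [p ->] := quot_projP v; rewrite size_map => lt.
  have x0 : 'I_m by case: (t) lt => [|x].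
  set i0 := nth x0 t k.
  rewrite (nth_map x0) // -map_take scale_quot_proj !quot_seq_submoduleP => h a ap.
  have : (a + U_(i0))%MM \in msupp ('X_i0 * p).
    by rewrite mulrC (perm_mem (msuppMX _ _)) addmC; apply: map_f.
  move=> /h /orP[/hu -> //|/hasP[i it ai]]; first exact: mem_nth.
  apply/orP; right; apply/hasP; exists i => //.
  move: ai; rewrite mnmDE mnm1E; case: (i0 =P i) => [E|_]; last by rewrite /= addn0.
  move: ut; rewrite -(cat_take_drop k t) (drop_nth x0) // cat_uniq /= => /and3P[_ /norP[/negP[]]].
  by rewrite -/i0 E.
exists (quot_proj g 1); rewrite quot_seq_submoduleP => /(_ 0%MM).
rewrite msupp1 inE eqxx (negPf h0) => /(_ isT) /= /hasP[i _].
by rewrite mnm0E.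
Qed.

End MonomialRegular.

(** * Modules realising sums of terms t^a/(1-t)^j with [j >= r] *)

Definition has_K_dim (K : fieldType) m (M : graded_module K m) d k :=
  exists b : 'I_k -> M, K_basis (@gm_part K m M d) b.

Section VariableQuotient.
Variables (K : fieldType) (m j : nat).
Hypothesis jm : (j <= m)%N.

Definition high_var (i : {i : 'I_m | (j <= i)%N}) : {mpoly K[m]} := 'X_(val i).

Lemma high_var_homog i : exists k : nat, high_var i \is k.-homog.
Proof. by exists 1%N; rewrite dhomogX /= mdeg1. Qed.

(** This is S/(X_j, ..., X_(m-1)), a polynomial ring in the first [j] variables, with Hilbert series
    1/(1-t)^j. *)
Definition low_var_module : graded_module K m := graded_quot high_var_homog.

Let u (i : {i : 'I_m | (j <= i)%N}) : 'X_{1..m} := U_(val i).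

Let in_uP (a : 'X_{1..m}) : reflect (exists2 i : 'I_m, (j <= i)%N & a i != 0%N) (in_monomial_ideal u a).
Proof.
apply: (iffP existsP) => [[[i ji]]|[i ji ai]].
  by rewrite lep1mP => ai; exists i.
by exists (exist _ i ji); rewrite lep1mP.
Qed.

Lemma low_var_module_dim (e : nat) : has_K_dim low_var_module e (multichoose j e).
Proof.
rewrite -(size_monomials_on (widen_ord jm)).
exists (fun i => quot_proj high_var 'X_[nth 0%MM (monomials_on (widen_ord jm) e) i]).
apply: (@quot_K_basis _ _ _ high_var u) => //.
  by apply: monomials_on_uniq => x y /(congr1 val) /= /val_inj.
have winj : injective (widen_ord jm) by move=> x y /(congr1 val) /= /val_inj.
move=> a; rewrite mem_monomials_on //; congr (_ && _); apply/forall_inP/negP.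
  move=> h /in_uP[i ji]; rewrite (eqP (h i _)) //; apply/codomP => -[k E].
  by move: ji; rewrite E /= leqNgt ltn_ord.
move=> h i ni; apply/negPn/negP => ai; apply: h; apply/in_uP; exists i => //.
rewrite leqNgt; apply: contra ni => lt; apply/codomP.
by exists (Ordinal lt); apply: val_inj.
Qed.

Lemma low_var_module_regular r (rj : (r <= j)%N) :
  regular_sequence low_var_module
    [seq 'X_i | i <- [seq widen_ord (leq_trans rj jm) k | k <- enum 'I_r]].
Proof.
apply: (@quot_regular_sequence _ _ _ high_var u) => //.
- by rewrite map_inj_uniq ?enum_uniq // => x y /(congr1 val) /= /val_inj.
- move=> i a /mapP[k _ ->] /in_uP[l jl]; rewrite mnmDE mnm1E => al.
  apply/in_uP; exists l => //; move: al; case: (_ =P l) => [E|_]; last by rewrite /= addn0.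
  by move: jl; rewrite -E /= leqNgt (leq_trans (ltn_ord k) rj).
- by apply/in_uP => -[i _]; rewrite mnm0E.
Qed.

End VariableQuotient.

(** Each term t^a/(1-t)^j is realised by a shifted [low_var_module], on which the first [r]
    variables are regular since [r <= j]; both properties pass to the direct sum. A nonempty [L]
    avoids the zero module, which has no regular sequence. *)
Lemma high_dim_module (K : fieldType) m r (rm : (r <= m)%N) (L : seq (nat * nat)) :
  L != [::] -> all (fun ja => r <= ja.1 <= m)%N L ->
  exists N : graded_module K m,
  [/\ finitely_generated N,
      forall e : nat, has_K_dim N e (\sum_(ja <- L) shift_coef ja.1 ja.2 e)%N,
      forall e : nat, has_K_dim N (Negz e) 0 &
      regular_sequence N [seq 'X_i | i <- [seq widen_ord rm k | k <- enum 'I_r]]].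
Proof.
have single j a : (r <= j)%N -> (j <= m)%N -> exists N : graded_module K m,
  [/\ finitely_generated N,
      forall e : nat, has_K_dim N e (shift_coef j a e),
      forall e : nat, has_K_dim N (Negz e) 0 &
      regular_sequence N [seq 'X_i | i <- [seq widen_ord rm k | k <- enum 'I_r]]].
  move=> rj jm; exists (shift_module (low_var_module K m j) a); split.
  - exact: quot_finitely_generated.
  - move=> e; rewrite /shift_coef; case: leqP => ae.
      have := low_var_module_dim K jm (e - a); rewrite /has_K_dim /= /shift_part.
      by rewrite subzn.
    (* For [e < a] the unshifted degree is negative and its part is 0; [Negz p] is [-(p + 1)], hence
       the predecessor. *)
    have E : e%:Z - a%:Z = Negz (a - e).-1 by lia.
    exists (fun=> 0); rewrite /= /shift_part E; exact: quot_K_basis_neg.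
  - move=> e; have E : Negz e - a%:Z = Negz (e + a) by lia.
    exists (fun=> 0); rewrite /= /shift_part E; exact: quot_K_basis_neg.
  - have := low_var_module_regular K jm rj.
    by rewrite (bool_irrelevance (leq_trans rj jm) rm).
elim: L => // -[j a] L IH _ /= /andP[/andP[rj jm] Lr].
have [N1 [fg1 b1 n1 r1]] := single j a rj jm.
case: L IH Lr => [_ _|x L /(_ isT) IH /IH [N2 [fg2 b2 n2 r2]]].
  by exists N1; split=> // e; rewrite big_seq1.
exists (prod_module N1 N2); split.
- exact: prod_finitely_generated.
- move=> e; rewrite big_cons; have [c1 h1] := b1 e; have [c2 h2] := b2 e.
  exact: prod_K_basis h1 h2.
- move=> e; have [c1 h1] := n1 e; have [c2 h2] := n2 e.
  exact: prod_K_basis h1 h2.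
- exact: prod_regular_sequence.
Qed.

(** * The Hilbert series of S/I and the bound on its Hilbert depth *)

Section EdgeIdealHilbert.
Variables (K : fieldType) (n : nat).

Let u (ij : 'I_n * 'I_n) : 'X_{1..n + n} := (U_(lshift n ij.1) + U_(rshift n ij.2))%MM.

Let in_uPn (a : 'X_{1..n + n}) : reflect ((forall i, a (lshift n i) = 0%N) \/ (forall i, a (rshift n i) = 0%N))
                       (~~ in_monomial_ideal u a).
Proof.
apply: (iffP idP) => [na|h].
  have [/forallP h|] := boolP [forall i, a (lshift n i) == 0%N].
    by left=> i; apply/eqP.
  rewrite negb_forall => /existsP[i ai]; right=> k; apply/eqP/negPn/negP => ak.
  move/negP: na; apply; apply/existsP; exists (i, k); apply/mnm_lepP => l.
  rewrite mnmDE !mnm1E; case: eqP => [<-|_].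
    by rewrite eq_rlshift /= addn0 lt0n.
  by case: eqP => [<-|//]; rewrite lt0n.
apply/negP => /existsP[[i k] /mnm_lepP le].
have := le (lshift n i); have := le (rshift n k).
rewrite !mnmDE !mnm1E /= !eqxx addn1 add1n.
by case: h => ->.
Qed.

(** The monomials outside the ideal are those in the x alone and those in the y alone,
    [multichoose n e] of each; only the monomial 1, in degree 0, is counted twice. *)
Lemma S_mod_I_dim (e : nat) :
  has_K_dim (S_mod_I K n) e (2 * multichoose n e - (e == 0))%N.
Proof.
have gE ij : xy_gen K ij = 'X_[u ij] by rewrite mpolyXD.
pose s : seq 'X_{1..n + n} := if e is 0 then [:: 0%MM] else
  monomials_on (@lshift n n) e ++ monomials_on (@rshift n n) e.
have -> : (2 * multichoose n e - (e == 0) = size s)%N.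
  rewrite /s; case: (e) => [|f]; first by rewrite multichoosen0.
  by rewrite size_cat !size_monomials_on; lia.
exists (fun i => quot_proj (@xy_gen K n) 'X_[nth 0%MM s i]).
have inL a f : (a \in monomials_on (@lshift n n) f) = (mdeg a == f) && [forall i, a (rshift n i) == 0%N].
  rewrite mem_monomials_on; last exact: lshift_inj.
  congr (_ && _); apply/forall_inP/forallP => h i.
    apply: h; apply/codomP => -[k /eqP]; by rewrite eq_rlshift.
  case: (split_ordP i) => k ->; last by rewrite (eqP (h k)).
  by rewrite codom_f.
have inR a f : (a \in monomials_on (@rshift n n) f) = (mdeg a == f) && [forall i, a (lshift n i) == 0%N].
  rewrite mem_monomials_on; last exact: rshift_inj.
  congr (_ && _); apply/forall_inP/forallP => h i.
    apply: h; apply/codomP => -[k /eqP]; by rewrite eq_lrshift.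
  case: (split_ordP i) => k ->; first by rewrite (eqP (h k)).
  by rewrite codom_f.
apply: (@quot_K_basis _ _ _ (@xy_gen K n) u) => //; rewrite /s; case: (e) => [|f] //.
- rewrite cat_uniq !monomials_on_uniq ?andbT /=; [|exact: rshift_inj|exact: lshift_inj].
  apply/hasPn => a /=; rewrite inL inR => /andP[/eqP af /forallP hl].
  rewrite af eqxx /=; apply/negP => /forallP hr.
  move: af; rewrite (_ : a = 0%MM) ?mdeg0 //; apply/mnmP => i; rewrite mnm0E.
  by case: (split_ordP i) => k ->; apply/eqP.
- move=> a; rewrite inE mdeg_eq0; case: eqP => //= ->; symmetry.
  by apply/in_uPn; left=> i; rewrite mnm0E.
- move=> a; rewrite mem_cat inL inR -andb_orr; congr (_ && _).
  apply/orP/in_uPn => [[] /forallP h|[] h].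
  + by right=> i; apply/eqP.
  + by left=> i; apply/eqP.
  + by right; apply/forallP => i; apply/eqP.
  + by left; apply/forallP => i; apply/eqP.
Qed.

Lemma S_mod_I_dim_neg e : has_K_dim (S_mod_I K n) (Negz e) 0.
Proof. by exists (fun=> 0); apply: quot_K_basis_neg. Qed.

Lemma hdepth_S_mod_I_ge (R : realType) r : (0 < n)%N -> (r <= n)%N ->
  (forall d, ~~ odd d -> 'C(r, d) <= 2 * multichoose (n - r) d)%N ->
  ((r%:R : R)%:E <= hdepth R (S_mod_I K n))%E.
Proof.
move=> n0 rn h; have [L Lr hL] := hilbert_decomposition rn h.
have rm : (r <= n + n)%N by lia.
have Lr' : all (fun ja => r <= ja.1 <= n + n)%N L.
  by apply: sub_all Lr => -[j a] /=; lia.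
(* In degree 0 the sum over [L] is 2 - 1 = 1. *)
have L0 : L != [::].
  by apply/eqP => L0; have := hL 0%N; rewrite L0 big_nil multichoosen0.
have [N [fg hN nN reg]] := high_dim_module K rm L0 Lr'.
apply: (@le_trans _ _ (depth R N)); apply: ereal_sup_ubound.
  exists [seq 'X_i | i <- [seq widen_ord rm k | k <- enum 'I_r]].
    split=> // _ /mapP[i _ ->]; rewrite /in_irrelevant_ideal mcoeffX.
    by rewrite mnm1_eq0.
  by rewrite 2!size_map size_enum_ord.
exists N; split=> // -[e|e].
  have [b /hilbert_functionE ->] := hN e; have [b' /hilbert_functionE ->] := S_mod_I_dim e.
  exact: hL.
have [b /hilbert_functionE ->] := nN e.
by have [b' /hilbert_functionE ->] := S_mod_I_dim_neg e.
Qed.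

End EdgeIdealHilbert.

Theorem proposition4p2 (R : realType) (K : fieldType)
  (ha : forall s : nat, (0 < s)%N -> forall k : int,
     ((2 * s)%:R + 1 / 2) ^+ 2 / ln 2 <= k%:~R :> R ->
     \prod_(1 <= j < (2 * s).+1) (1 + (2 * s + 1)%:R / (k%:~R - j%:R)) <= 2 :> R)
  (hb : forall s : nat, (0 < s)%N -> forall k : int,
     ((2 * s)%:R + 3 / 2) ^+ 2 / ln 2 <= k%:~R :> R ->
     \prod_(1 <= j < (2 * s + 1).+1) (1 + (2 * s + 2)%:R / (k%:~R - j%:R)) <= 2 :> R)
  (hc : forall s : nat, (0 < s)%N -> forall k : int,
     (4 * s ^ 2)%:R / ln 2 <= k%:~R :> R ->
     \prod_(0 <= j < (2 * s - 1).+1) (1 + (2 * s)%:R / (k%:~R - j%:R)) <= 2 :> R)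
  (hd : forall s : nat, (0 < s)%N -> forall k : int,
     (2 * s + 1)%:R ^+ 2 / ln 2 <= k%:~R :> R ->
     \prod_(2 <= j < (2 * s + 1).+1) (1 + (2 * s + 2)%:R / (k%:~R - j%:R)) <= 2 :> R)
  (n : nat) (hn : (1 <= n)%N) :
  (((Num.floor ((n%:R - 1) / 2 + Num.sqrt ((n %/ 2)%:R * ln 2) : R))%:~R : R)%:E
     <= hdepth R (S_mod_I K n))%E.
Proof.
have [r [-> hr]] := floor_sqrt_bound R hn.
have [rn hC] : (r <= n)%N /\
    forall d, ~~ odd d -> ('C(r, d) <= 2 * multichoose (n - r) d)%N.
  (* The term [(n - 1) / 2] is [k] for [n = 2 * k + 1] and [k - 1/2] for [n = 2 * k], which matches
     the bounds on [r] in the two parity lemmas. *)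
  have := odd_double_half n; rewrite -divn2; set k := (n %/ 2)%N in hr *.
  case: (odd n) => /= En; move: hr; rewrite -En.
    rewrite natrD -muln2 natrM => hr.
    have le d := @bin_le_odd R k r d hc hd.
    split=> [|d]; first by have [|] := le 0%N; [lra | lia].
    have [|_] := le d; first by lra.
    by rewrite add1n [(k * 2)%N]mulnC.
  rewrite add0n -muln2 natrM => hr.
  have [||rk le] := bin_le_even (k := k) (r := r) ha hb; [lia|lra|].
  by split=> [|d _]; [lia | rewrite [(k * 2)%N]mulnC].
exact: hdepth_S_mod_I_ge.
Qed.
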